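(* For every digital circle $C$ with basepoint $x_0\in C$, the digital fundamental group satisfies $\pi_1(C;x_0)\cong\mathbb{Z}$.
   Context: A digital image is a finite subset $X\subseteq\mathbb{Z}^n$ (for some $n$) with the adjacency relation $x\sim_X y$ iff $|x_i-y_i|\le 1$ for all $i=1,\ldots,n$ (reflexive and symmetric). A based digital image also has a chosen basepoint $x_0\in X$. A function $f\colon X\to Y$ of digital images is continuous if $x\sim_X x'$ implies $f(x)\sim_Y f(x')$. For $N\ge 0$, $I_N=\{0,1,\ldots,N\}\subseteq\mathbb{Z}$. Products carry the adjacency $(x,y)\sim(x',y')$ iff $x\sim x'$ and $y\sim y'$. A based loop of length $N$ in $X$ is a continuous $\alpha\colon I_N\to X$ with $\alpha(0)=\alpha(N)=x_0$. Based loops $\alpha,\beta\colon I_M\to X$ of the same length are based homotopic as based loops, $\alpha\approx\beta$, if for some $R\ge1$ there is a continuous $H\colon I_M\times I_R\to X$ with $H(s,0)=\alpha(s)$, $H(s,R)=\beta(s)$ and $H(0,t)=H(M,t)=x_0$ for all $s,t$. For $k\ge1$ let $\rho_k\colon I_{kN+k-1}\to I_N$, $\rho_k(i)=\lfloor i/k\rfloor$. Based loops $\alpha\colon I_M\to X$, $\beta\colon I_N\to X$ are subdivision-based homotopic if for some $k,l\ge1$ with $k(M+1)=l(N+1)$ we have $\alpha\circ\rho_k\approx\beta\circ\rho_l$ as based loops. This is an equivalence relation on the based loops of all lengths; the digital fundamental group $\pi_1(X;x_0)$ is the set of classes $[\alpha]$. It is a group under $[\alpha]\cdot[\beta]=[\alpha\cdot\beta]$,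 where for $\alpha\colon I_M\to X$, $\beta\colon I_N\to X$ the loop $\alpha\cdot\beta\colon I_{M+N+1}\to X$ equals $\alpha(t)$ for $0\le t\le M$ and $\beta(t-(M+1))$ for $M+1\le t\le M+N+1$; the identity is the class of constant loops, and inverses are given by reversing loops. A digital circle (of length $N$) is a digital image $C=\{x_0,x_1,\ldots,x_{N-1}\}$ of $N$ distinct points in $\mathbb{Z}^n$, with $N\ge4$ and any $n\ge2$, such that $x_i\sim_C x_{i+1}$ for $0\le i\le N-2$ and $x_{N-1}\sim_C x_0$, and there are no other adjacencies amongst distinct elements of $C$. *)

(* Defs.v *)
From HB Require Import structures.
From mathcomp Require Import all_boot all_order all_algebra.
From mathcomp Require Import finmap boolp zify.

Set Implicit Arguments.
Unset Strict Implicit.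
Unset Printing Implicit Defensive.

Import GRing.Theory Num.Theory.
Local Open Scope ring_scope.
Local Open Scope fset_scope.
Local Open Scope nat_scope.

(* A digital image is a finite set X : {fset 'rV[int]_n}; it is used through
   its coercion to the finite type of its points. *)
Definition adj (n : nat) : rel 'rV[int]_n :=
  fun x y => [forall i, `|x ord0 i - y ord0 i| <= 1]%R.

Definition adjX (n : nat) (X : {fset 'rV[int]_n}) : rel X :=
  fun x y => adj (val x) (val y).

(* The interval I_N = {0, ..., N} is the type 'I_N.+1. *)
Definition adjI (N : nat) : rel 'I_N.+1 :=
  fun i j => (`|(i : nat)%:Z - (j : nat)%:Z| <= 1)%R.

Definition adj_prod (S T : Type) (eS : rel S) (eT : rel T) : rel (S * T) :=
  fun p q => eS p.1 q.1 && eT p.2 q.2.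

Definition continuous (S T : finType) (eS : rel S) (eT : rel T) (f : S -> T) :=
  [forall s, forall s', eS s s' ==> eT (f s) (f s')].

(* The N points are indexed cyclically: ordS i is i + 1 modulo N. *)
Definition digital_circle (n N : nat) (C : {fset 'rV[int]_n}) : Prop :=
  [/\ 2 <= n, 4 <= N &
      exists x : 'I_N -> 'rV[int]_n,
        [/\ injective x, C =i codom x &
            forall i j, i != j ->
              adj (x i) (x j) = (j == ordS i) || (i == ordS j)]].

Section Loops.
Variables (n : nat) (X : {fset 'rV[int]_n}) (x0 : X).

Definition is_based_loop (M : nat) (a : 'I_M.+1 -> X) : bool :=
  [&& continuous (@adjI M) (@adjX n X) a, a ord0 == x0 & a ord_max == x0].

Record based_loop := BasedLoop {
  loop_data : {M : nat & {ffun 'I_M.+1 -> X}};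
  loop_dataP : is_based_loop (tagged loop_data) }.

HB.instance Definition _ := [isSub for loop_data].
HB.instance Definition _ := [Choice of based_loop by <:].

Definition len (a : based_loop) : nat := tag (loop_data a).
Definition loop_fun (a : based_loop) : {ffun 'I_(len a).+1 -> X} :=
  tagged (loop_data a).

Definition mk_loop (M : nat) (a : 'I_M.+1 -> X)
    (aP : is_based_loop [ffun i => a i]) : based_loop :=
  @BasedLoop (Tagged (fun M => {ffun 'I_M.+1 -> X}) [ffun i => a i]) aP.

Definition based_homotopic (M : nat) (a b : 'I_M.+1 -> X) : Prop :=
  exists R : nat, 1 <= R /\
  exists H : 'I_M.+1 * 'I_R.+1 -> X,
    [/\ continuous (adj_prod (@adjI M) (@adjI R)) (@adjX n X) H,
        forall s, H (s, ord0) = a s,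
        forall s, H (s, ord_max) = b s &
        forall t, H (ord0, t) = x0 /\ H (ord_max, t) = x0].

(* The projection rho_k : I_K -> I_N for K = k * N + k - 1.  To avoid casts
   between ordinals, K is a separate parameter, and rho is only used when
   K.+1 = k * N.+1; then i %/ k <= N, so that inord is harmless. *)
Definition rho (k K N : nat) (i : 'I_K.+1) : 'I_N.+1 := inord (i %/ k).

Definition subdivision_homotopic (a b : based_loop) : Prop :=
  exists k l K : nat,
    [/\ 1 <= k, 1 <= l, K.+1 = k * (len a).+1, K.+1 = l * (len b).+1 &
        based_homotopic (fun i : 'I_K.+1 => loop_fun a (rho k (len a) i))
                        (fun i : 'I_K.+1 => loop_fun b (rho l (len b) i))].

Definition loop_cat_fun (M N : nat) (a : 'I_M.+1 -> X) (b : 'I_N.+1 -> X)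
    (t : 'I_(M + N + 1).+1) : X :=
  if t <= M then a (inord t) else b (inord (t - M.+1)).

Definition loop_rev_fun (M : nat) (a : 'I_M.+1 -> X) (t : 'I_M.+1) : X :=
  a (rev_ord t).

(* The proofs below replace functions on 'I_M.+1 by functions on nat that are
   only considered on the integers at most M. *)

Definition nadj (s t : nat) := (s <= t.+1) && (t <= s.+1).

Definition ncont (M : nat) (a : nat -> X) := forall s s',
  s <= M -> s' <= M -> nadj s s' -> adjX (a s) (a s').

Definition nloop M a := [/\ ncont M a, a 0 = x0 & a M = x0].

Definition nhom (M : nat) (a b : nat -> X) : Prop :=
  exists R (H : nat -> nat -> X),
  [/\ forall s s' t t', s <= M -> s' <= M -> t <= R -> t' <= R ->
        nadj s s' -> nadj t t' -> adjX (H s t) (H s' t'),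
      forall s, s <= M -> H s 0 = a s,
      forall s, s <= M -> H s R = b s &
      forall t, t <= R -> H 0 t = x0 /\ H M t = x0].

Lemma adjX_refl (x : X) : adjX x x.
Proof. by apply/forallP => i; rewrite subrr normr0. Qed.

Lemma adjX_sym (x y : X) : adjX x y = adjX y x.
Proof. by apply: eq_forallb => i; rewrite distrC. Qed.

Lemma adjIE N (i j : 'I_N.+1) : adjI i j = nadj i j.
Proof. rewrite /adjI /nadj; apply/idP/idP; lia. Qed.

Definition nx (M : nat) (a : 'I_M.+1 -> X) (s : nat) : X := a (inord s).

Lemma nxE M (a : 'I_M.+1 -> X) (i : 'I_M.+1) : nx a i = a i.
Proof. by rewrite /nx inord_val. Qed.

Lemma nx0 M (a : 'I_M.+1 -> X) : nx a 0 = a ord0.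
Proof. by rewrite -nxE. Qed.

Lemma nxM M (a : 'I_M.+1 -> X) : nx a M = a ord_max.
Proof. by rewrite -[in RHS]nxE. Qed.

Lemma based_homotopicP M (a b : 'I_M.+1 -> X) :
  based_homotopic a b <-> nhom M (nx a) (nx b).
Proof.
split=> [[R [_ [H [Hc Ha Hb H0]]]] | [R [H [Hc Ha Hb H0]]]].
  exists R, (fun s t => H (inord s, inord t)); split.
  - move=> s s' t t' sM s'M tR t'R ss' tt'.
    move/forallP: Hc => /(_ (inord s, inord t))/forallP.
    move=> /(_ (inord s', inord t'))/implyP; apply.
    by rewrite /adj_prod /= !adjIE !inordK // ss' tt'.
  - by move=> s sM; rewrite -[inord 0]/(inord (@ord0 R)) inord_val Ha.
  - by move=> s sM; rewrite -[inord R]/(inord (@ord_max R)) inord_val Hb.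
  move=> t tR; rewrite -[inord 0]/(inord (@ord0 M)) inord_val.
  by rewrite -[inord M]/(inord (@ord_max M)) inord_val; apply: H0.
exists R.+1; split=> //.
exists (fun p : 'I_M.+1 * 'I_R.+2 => H p.1 (minn p.2 R)); split.
- apply/forallP => -[s t]; apply/forallP => -[s' t']; apply/implyP.
  rewrite /adj_prod /= !adjIE => /andP[ss' tt'].
  apply: Hc; rewrite ?geq_minr ?leq_ord //.
  by move: tt'; rewrite /nadj; lia.
- by move=> s /=; rewrite min0n Ha ?nxE // leq_ord.
- by move=> s /=; rewrite (minn_idPr _) // Hb ?nxE // leq_ord.
by move=> t /=; apply: H0; rewrite geq_minr.
Qed.

Lemma nhom_ext M a b a' b' : (forall s, s <= M -> a s = a' s) ->
  (forall s, s <= M -> b s = b' s) -> nhom M a b -> nhom M a' b'.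
Proof.
move=> ea eb [R [H [Hc Ha Hb H0]]]; exists R, H; split=> //.
  by move=> s sM; rewrite Ha // ea.
by move=> s sM; rewrite Hb // eb.
Qed.

Lemma nhom_step M a b : nloop M a -> nloop M b ->
  (forall s s', s <= M -> s' <= M -> nadj s s' -> adjX (a s) (b s')) ->
  nhom M a b.
Proof.
move=> [ac a0 aM] [bc b0 bM] ab.
exists 1, (fun s t => if t == 0 then a s else b s); split=> //.
  move=> s s' [|t] [|t'] sM s'M _ _ ss' _ /=; [exact: ac| exact: ab | |exact: bc].
  by rewrite adjX_sym; apply: ab => //; rewrite /nadj andbC.
by move=> [|t] _.
Qed.

Lemma nhom_refl M a : nloop M a -> nhom M a a.
Proof. by move=> aP; apply: nhom_step => //; case: aP. Qed.

Lemma nhom_sym M a b : nhom M a b -> nhom M b a.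
Proof.
move=> [R [H [Hc Ha Hb H0]]]; exists R, (fun s t => H s (R - t)); split.
- move=> s s' t t' sM s'M tR t'R ss' tt'; apply: Hc => //; try lia.
  by move: tt'; rewrite /nadj; lia.
- by move=> s sM; rewrite subn0 Hb.
- by move=> s sM; rewrite subnn Ha.
by move=> t tR; apply: H0; lia.
Qed.

Lemma nhom_trans M b a c : nhom M a b -> nhom M b c -> nhom M a c.
Proof.
move=> [R [H [Hc Ha Hb H0]]] [S [G [Gc Gb Gc' G0]]].
exists (R + S), (fun s t => if t <= R then H s t else G s (t - R)); split.
- move=> s s' t t' sM s'M tR t'R ss' tt'.
  case: ifP => h; case: ifP => h'.
  + exact: Hc.
  + have -> : t = R by move: tt' h h'; rewrite /nadj; lia.
    by rewrite Hb // -Gb //; apply: Gc => //; move: tt' h h'; rewrite /nadj; lia.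
  + have -> : t' = R by move: tt' h h'; rewrite /nadj; lia.
    by rewrite Hb // -Gb //; apply: Gc => //; move: tt' h h'; rewrite /nadj; lia.
  + by apply: Gc => //; move: tt' h h'; rewrite /nadj; lia.
- by move=> s sM; rewrite leq0n Ha.
- move=> s sM; case: ifP => h; last by rewrite addKn Gc'.
  have S0 : S = 0 by lia.
  by rewrite S0 addn0 Hb // -Gb // -Gc' // S0.
by move=> t tR; case: ifP => h; [apply: H0 | apply: G0; lia].
Qed.

Lemma nadj_div k s t : 0 < k -> nadj s t -> nadj (s %/ k) (t %/ k).
Proof.
move=> k0; rewrite /nadj.
have h u v : u <= v.+1 -> u %/ k <= (v %/ k).+1.
  move=> uv; have -> : (v %/ k).+1 = (v + k) %/ k.
    by rewrite divnDr // divnn k0 addn1.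
  by apply: leq_div2r; lia.
by move=> /andP[/h -> /h ->].
Qed.

Lemma div_last k K N : K.+1 = k * N.+1 -> K %/ k = N.
Proof.
move=> e; have k0 : 0 < k by case: k e => //; rewrite mul0n.
have -> : K = N * k + k.-1 by nia.
by rewrite divnMDl // divn_small ?addn0 //; lia.
Qed.

Lemma div_bound k K N s : K.+1 = k * N.+1 -> s <= K -> s %/ k <= N.
Proof. by move=> e sK; rewrite -(div_last e); apply: leq_div2r. Qed.

Lemma nloop_sub k K N a : K.+1 = k * N.+1 -> nloop N a ->
  nloop K (fun s => a (s %/ k)).
Proof.
move=> e [ac a0 aN]; have k0 : 0 < k by case: k e => //; rewrite mul0n.
split; rewrite ?div0n ?(div_last e) // => s s' sK s'K ss'.
by apply: ac; rewrite ?(div_bound e) //; apply: nadj_div.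
Qed.

Lemma nhom_sub k K N a b : K.+1 = k * N.+1 -> nhom N a b ->
  nhom K (fun s => a (s %/ k)) (fun s => b (s %/ k)).
Proof.
move=> e [R [H [Hc Ha Hb H0]]].
have k0 : 0 < k by case: k e => //; rewrite mul0n.
exists R, (fun s => H (s %/ k)); split.
- move=> s s' t t' sM s'M tR t'R ss' tt'.
  by apply: Hc; rewrite ?(div_bound e) //; apply: nadj_div.
- by move=> s sM; rewrite Ha // (div_bound e).
- by move=> s sM; rewrite Hb // (div_bound e).
by move=> t tR; rewrite div0n (div_last e); apply: H0.
Qed.

(* Weakly monotone surjective reparametrizations I_K -> I_L *)
Definition repar K L (f : nat -> nat) :=
  [/\ forall s, s < K -> f s <= f s.+1 <= (f s).+1, f 0 = 0 & f K = L].

Lemma repar_mono K L f s t : repar K L f -> s <= t -> t <= K -> f s <= f t.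
Proof.
move=> [fm _ _]; elim: t => [|t IH]; first by rewrite leqn0 => /eqP->.
rewrite leq_eqVlt => /predU1P[-> //|]; rewrite ltnS => st tK.
by apply: leq_trans (IH st (ltnW tK)) _; case/andP: (fm t tK).
Qed.

Lemma repar_bound K L f s : repar K L f -> s <= K -> f s <= L.
Proof.
move=> fP sK; have := repar_mono fP sK (leqnn K).
by case: fP => _ _ ->.
Qed.

Lemma repar_nadj K L f s t : repar K L f -> s <= K -> t <= K -> nadj s t ->
  nadj (f s) (f t).
Proof.
move=> [fm _ _] sK tK st.
have : [\/ t = s, t = s.+1 | s = t.+1].
  have [h|h|h] := ltngtP s t; [apply: Or32 | apply: Or33 | apply: Or31];
    by move: st; rewrite /nadj; lia.
rewrite /nadj; case=> e; subst.
- by rewrite leqnSn.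
- by have := fm s tK; lia.
by have := fm t sK; lia.
Qed.

Lemma nloop_repar K L f a : repar K L f -> nloop L a ->
  nloop K (fun s => a (f s)).
Proof.
move=> fP [ac a0 aL]; split; last by case: fP => _ _ ->.
  move=> s s' sK s'K ss'; apply: ac; rewrite ?(repar_bound fP) //.
  exact: (repar_nadj fP).
by case: fP => _ ->.
Qed.

Lemma repar_hom_le K L f g a : nloop L a -> repar K L f -> repar K L g ->
  (forall s, s <= K -> g s <= f s) -> nhom K (fun s => a (f s)) (fun s => a (g s)).
Proof.
move=> aP + gP.
have [d] := ubnP (\sum_(s < K.+1) (f s - g s)).
elim: d f => // d IH f; rewrite ltnS => fd fP gf.
have [/existsP ex|no] := boolP [exists s : 'I_K.+1, g s < f s]; last first.
  have e s : s <= K -> f s = g s.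
    move=> sK; apply/eqP; rewrite eqn_leq gf // andbT leqNgt.
    by apply: contra no => h; apply/existsP; exists (Ordinal (sK : s < K.+1)).
  apply: (@nhom_ext _ (fun s => a (f s)) (fun s => a (f s))) => //.
    by move=> s sK; rewrite e.
  by apply: nhom_refl; apply: nloop_repar fP aP.
have exP : exists s, (s <= K) && (g s < f s).
  by case: ex => s h; exists s; rewrite h -ltnS ltn_ord.
have bdP s : (s <= K) && (g s < f s) -> s <= K by case/andP.
case: (ex_maxnP exP bdP) => s /andP[sK gfs] smax.
have [fm f0 fK] := fP; have [gm g0 gK] := gP.
have ltsK : s < K.
  by rewrite ltn_neqAle sK andbT; apply/eqP => e; move: gfs; rewrite e fK gK ltnn.
have fs1 : f s.+1 = f s.
  have h : ~~ (g s.+1 < f s.+1).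
    by apply/negP => h; have := smax s.+1; rewrite ltsK h ltnn => /(_ isT).
  by have := fm s ltsK; have := gm s ltsK; lia.
have exj : exists j, f j == f s by exists s.
case: (ex_minnP exj) => j /eqP fj jmin.
have js : j <= s by apply: jmin.
have j0 : 0 < j by rewrite lt0n; apply/eqP => e; move: gfs; rewrite -fj e f0.
have fjp : f j.-1 = (f j).-1.
  have jK : j.-1 < K by lia.
  have := fm _ jK; rewrite prednK // => h.
  have : f j.-1 != f s by apply/eqP => /eqP/jmin; lia.
  by rewrite -fj; lia.
have fj1 : f j.+1 = f j.
  have [->//|js'] := eqVneq j s.
  have h : j < s by lia.
  have := fm j; have := repar_mono fP h sK; rewrite fj; lia.
have gj : g j < f j by rewrite fj; apply: leq_ltn_trans (repar_mono gP js sK) gfs.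
pose f' (t : nat) : nat := if t == j then (f j).-1 else f t.
have f'P : repar K L f'.
  split; rewrite /f'; last 2 first.
  - by rewrite ifN ?f0 //; lia.
  - by rewrite ifN //; lia.
  move=> t tK; have h := fm t tK.
  case: (eqVneq t j) => [e|tj]; first by rewrite ifN; [rewrite e fj1; lia|lia].
  case: (eqVneq t.+1 j) => [e|//].
  by have -> : t = j.-1 by [lia]; rewrite fjp; lia.
apply: (@nhom_trans _ (fun s => a (f' s))); last first.
  apply: IH => //; last first.
    move=> t tK; rewrite /f'; case: eqP => [->|_]; [lia | exact: gf].
  apply: leq_trans fd; have jK : j < K.+1 by lia.
  rewrite (bigD1 (Ordinal jK)) //= [X in _ < X](bigD1 (Ordinal jK)) //=.
  rewrite {1}/f' eqxx -addSn; apply: leq_add; first by lia.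
  apply: leq_sum => i; rewrite -val_eqE /= /f' => /negbTE-> //.
apply: nhom_step; [exact: nloop_repar fP aP | exact: nloop_repar f'P aP |].
move=> t t' tK t'K tt'; have [ac _ _] := aP.
apply: ac; rewrite ?(repar_bound fP) ?(repar_bound f'P) //.
rewrite /f'; case: eqP => [e|_]; last exact: repar_nadj fP _ _ tt'.
have : [\/ t = j.-1, t = j | t = j.+1].
  have [h|h|h] := ltngtP t j; [apply: Or31 | apply: Or33 | apply: Or32];
    by move: tt'; rewrite /nadj; lia.
by case=> ->; rewrite ?fjp ?fj1 /nadj; lia.
Qed.

Lemma repar_hom K L f g a : nloop L a -> repar K L f -> repar K L g ->
  nhom K (fun s => a (f s)) (fun s => a (g s)).
Proof.
move=> aP fP gP; have mP : repar K L (fun s => minn (f s) (g s)).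
  case: fP gP => [fm f0 fK] [gm g0 gK]; split; rewrite ?f0 ?g0 ?fK ?gK ?minnn //.
  by move=> s sK; have := fm s sK; have := gm s sK; lia.
apply: (@nhom_trans _ (fun s => a (minn (f s) (g s)))).
  by apply: (repar_hom_le aP) => // s _; apply: geq_minl.
by apply: nhom_sym; apply: (repar_hom_le aP) => // s _; apply: geq_minr.
Qed.

Lemma repar_div k K N : K.+1 = k * N.+1 -> repar K N (fun s => s %/ k).
Proof.
move=> e; have k0 : 0 < k by case: k e => //; rewrite mul0n.
split; rewrite ?div0n ?(div_last e) // => s sK.
rewrite leq_div2r //=.
have ss : nadj s.+1 s by rewrite /nadj; lia.
by have := nadj_div k0 ss; rewrite /nadj => /andP[].
Qed.

Lemma repar_comp K L M f g : repar K L f -> repar L M g ->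
  repar K M (fun s => g (f s)).
Proof.
move=> fP gP; have [fm f0 fK] := fP; have [gm g0 gL] := gP.
split; rewrite ?f0 ?fK // => s sK.
have := fm s sK; have := repar_bound fP sK => h1 h2.
have [->|h] : f s.+1 = f s \/ f s.+1 = (f s).+1 by lia.
  by rewrite leqnn leqnSn.
by rewrite h; apply: gm; rewrite -h; apply: (repar_bound fP).
Qed.

(* Subdivision-based homotopy, for loops seen as functions on nat *)
Definition nsub M a N b := exists k l K,
  [/\ 0 < k, 0 < l, K.+1 = k * M.+1, K.+1 = l * N.+1 &
      nhom K (fun s => a (s %/ k)) (fun s => b (s %/ l))].

Lemma nsub_sym M a N b : nsub M a N b -> nsub N b M a.
Proof.
by move=> [k [l [K [k0 l0 ek el /nhom_sym h]]]]; exists l, k, K; split.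
Qed.

Lemma nsub_trans N b M a P c : nsub M a N b -> nsub N b P c -> nsub M a P c.
Proof.
move=> [k [l [K [k0 l0 ek el h]]]] [k' [l' [K' [k'0 l'0 ek' el' h']]]].
have e1 : (k' * K.+1).-1.+1 = k' * K.+1 by lia.
have e2 : (k' * K.+1).-1.+1 = l * K'.+1 by rewrite e1 el ek' mulnCA.
exists (k' * k), (l * l'), (k' * K.+1).-1; split; rewrite ?muln_gt0 ?k0 ?l0 ?k'0 //.
- by rewrite e1 ek mulnA.
- by rewrite e2 el' mulnA.
apply: (@nhom_trans _ (fun s => b (s %/ (k' * l)))).
  by apply: nhom_ext (nhom_sub e1 h) => s _; rewrite -divnMA.
by apply: nhom_ext (nhom_sub e2 h') => s _; rewrite -divnMA // mulnC.
Qed.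

Lemma nhom_nsub M a b : nhom M a b -> nsub M a M b.
Proof.
move=> h; exists 1, 1, M; rewrite mul1n; split=> //.
by apply: nhom_ext h => s _; rewrite divn1.
Qed.

Lemma nsub_repar K L f a : nloop L a -> repar K L f ->
  nsub L a K (fun s => a (f s)).
Proof.
move=> aP fP; have e : (K.+1 * L.+1).-1.+1 = K.+1 * L.+1 by lia.
have e' : (K.+1 * L.+1).-1.+1 = L.+1 * K.+1 by rewrite e mulnC.
exists K.+1, L.+1, (K.+1 * L.+1).-1; split=> //.
by apply: (repar_hom aP (repar_div e)); apply: repar_comp fP; apply: repar_div.
Qed.

Definition ncat T M (a b : nat -> T) (s : nat) : T :=
  if s <= M then a s else b (s - M.+1).

Lemma nloop_cat M N a b : nloop M a -> nloop N b ->
  nloop (M + N + 1) (ncat M a b).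
Proof.
move=> [ac a0 aM] [bc b0 bN]; split; rewrite /ncat //.
  move=> s s' sK s'K ss'; case: ifP => h; case: ifP => h'.
  - exact: ac.
  - have -> : s = M by move: ss' h h'; rewrite /nadj; lia.
    have -> : s' = M.+1 by move: ss' h h'; rewrite /nadj; lia.
    by rewrite aM subnn b0 adjX_refl.
  - have -> : s' = M by move: ss' h h'; rewrite /nadj; lia.
    have -> : s = M.+1 by move: ss' h h'; rewrite /nadj; lia.
    by rewrite aM subnn b0 adjX_refl.
  by apply: bc; move: ss' h h'; rewrite /nadj; lia.
by rewrite ifN; [have -> : M + N + 1 - M.+1 = N by lia | lia].
Qed.

Lemma nhom_cat M N a b c d : nhom M a b -> nhom N c d ->
  nhom (M + N + 1) (ncat M a c) (ncat M b d).
Proof.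
move=> [R [H [Hc Ha Hb H0]]] [S [G [Gc Gb Gd G0]]].
exists (maxn R S),
  (fun s t => ncat M (fun s => H s (minn t R)) (fun s => G s (minn t S)) s).
have nmin P t t' : nadj t t' -> nadj (minn t P) (minn t' P) by rewrite /nadj; lia.
split; rewrite /ncat.
- move=> s s' t t' sM s'M tR t'R ss' tt'; case: ifP => h; case: ifP => h'.
  + by apply: Hc; rewrite ?geq_minr //; apply: nmin.
  + have -> : s = M by move: ss' h h'; rewrite /nadj; lia.
    have -> : s' = M.+1 by move: ss' h h'; rewrite /nadj; lia.
    by rewrite subnn (proj2 (H0 _ _)) ?(proj1 (G0 _ _)) ?adjX_refl // geq_minr.
  + have -> : s' = M by move: ss' h h'; rewrite /nadj; lia.
    have -> : s = M.+1 by move: ss' h h'; rewrite /nadj; lia.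
    by rewrite subnn (proj2 (H0 _ _)) ?(proj1 (G0 _ _)) ?adjX_refl // geq_minr.
  + by apply: Gc; rewrite ?geq_minr //; try exact: nmin;
      move: ss' h h'; rewrite /nadj; lia.
- by move=> s sM; rewrite !min0n; case: ifP => h; [rewrite Ha | rewrite Gb //; lia].
- move=> s sM; rewrite (minn_idPr (leq_maxl _ _)) (minn_idPr (leq_maxr _ _)).
  by case: ifP => h; [rewrite Hb | rewrite Gd //; lia].
move=> t tR; split; first by rewrite leq0n (proj1 (H0 _ _)) // geq_minr.
rewrite ifN; last by lia.
have -> : M + N + 1 - M.+1 = N by lia.
by rewrite (proj2 (G0 _ _)) // geq_minr.
Qed.

Lemma nsub_cat_repar M N a b M' N' f g :
  nloop M a -> nloop N b -> repar M' M f -> repar N' N g ->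
  nsub (M + N + 1) (ncat M a b)
       (M' + N' + 1) (ncat M' (fun s => a (f s)) (fun s => b (g s))).
Proof.
move=> aP bP fP gP; have [fm f0 fM] := fP; have [gm g0 gN] := gP.
pose h := ncat M' f (fun s => M.+1 + g s).
have hP : repar (M' + N' + 1) (M + N + 1) h.
  split; rewrite /h /ncat ?f0 //; last first.
    rewrite ifN; last by lia.
    by have -> : M' + N' + 1 - M'.+1 = N' by [lia]; rewrite gN; lia.
  move=> s sK; have [s1|s1|s1] := ltngtP s M'.
  - by have := fm s s1.
  - have -> : s.+1 - M'.+1 = (s - M'.+1).+1 by lia.
    by have := gm (s - M'.+1); lia.
  by rewrite s1 subnn g0 fM; lia.
have [k [l [K [k0 l0 ek el e]]]] := nsub_repar (nloop_cat aP bP) hP.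
exists k, l, K; split=> //; apply: nhom_ext e => // s sK.
move: (s %/ l) (div_bound el sK) => {s sK} s sK.
rewrite /h /ncat; case: (leqP s M') => h1; first by rewrite (repar_bound fP).
by rewrite ifN; [rewrite addKn | rewrite -ltnNge leq_addr].
Qed.

Lemma nsub_cat M a N b M' a' N' b' :
  nloop M a -> nloop N b -> nloop M' a' -> nloop N' b' ->
  nsub M a M' a' -> nsub N b N' b' ->
  nsub (M + N + 1) (ncat M a b) (M' + N' + 1) (ncat M' a' b').
Proof.
move=> aP bP a'P b'P [k [l [K [k0 l0 ek el h]]]] [m [p [L [m0 p0 em ep h']]]].
apply: nsub_trans (nsub_cat_repar aP bP (repar_div ek) (repar_div em)) _.
apply: nsub_trans (nhom_nsub (nhom_cat h h')) _.
exact/nsub_sym/(nsub_cat_repar a'P b'P (repar_div el) (repar_div ep)).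
Qed.

Lemma nsub_rev M a N b :
  nsub M a N b -> nsub M (fun s => a (M - s)) N (fun s => b (N - s)).
Proof.
move=> [k [l [K [k0 l0 ek el [R [H [Hc Ha Hb H0]]]]]]].
have dv p P s : K.+1 = p * P.+1 -> s <= K -> (K - s) %/ p = P - s %/ p.
  move=> e sK; have p0 : 0 < p by case: p e => //; rewrite mul0n.
  have hb := div_bound e sK; have hd := divn_eq s p; have hm := ltn_pmod s p0.
  have -> : K - s = (P - s %/ p) * p + (p.-1 - s %% p).
    have hp : s %/ p * p <= P * p by rewrite leq_mul2r hb orbT.
    by move: e; rewrite mulnBl mulnS (mulnC p P); lia.
  rewrite divnMDl // (@divn_small (_ - _)) ?addn0 //.
  by apply: leq_ltn_trans (leq_subr _ _) _; rewrite prednK.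
exists k, l, K; split=> //; exists R, (fun s t => H (K - s) t); split.
- move=> s s' t t' sM s'M tR t'R ss' tt'; apply: Hc => //; try lia.
  by move: ss'; rewrite /nadj; lia.
- by move=> s sK; rewrite Ha ?leq_subr // (dv _ M).
- by move=> s sK; rewrite Hb ?leq_subr // (dv _ N).
by move=> t tR; rewrite subn0 subnn; have [-> ->] := H0 t tR.
Qed.

Lemma nloop_rev M a : nloop M a -> nloop M (fun s => a (M - s)).
Proof.
move=> [ac a0 aM]; split; rewrite ?subn0 ?subnn // => s s' sM s'M ss'.
by apply: ac; rewrite ?leq_subr //; move: ss'; rewrite /nadj; lia.
Qed.

Lemma nloop_cst M : nloop M (fun=> x0).
Proof. by split=> // s s' _ _ _; apply: adjX_refl. Qed.

Lemma nsub_invr M a : nloop M a ->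
  nsub (M + M + 1) (ncat M a (fun s => a (M - s))) 0 (fun=> x0).
Proof.
move=> [ac a0 aM]; exists 1, (M + M + 1).+1, (M + M + 1).
rewrite mul1n muln1; split=> //.
exists M.+1, (fun s t => a (minn (minn s (M + M + 1 - s)) (M - t))); split.
- move=> s s' t t' sM s'M tR t'R ss' tt'; apply: ac; try lia.
  by move: ss' tt'; rewrite /nadj; lia.
- move=> s sK; rewrite subn0 divn1 /ncat; case: ifP => h; congr a; lia.
- by move=> s sK; rewrite -[RHS]a0; congr a; lia.
by move=> t tR; rewrite -a0; split; congr a; lia.
Qed.

Lemma nsub_idl M a : nloop M a -> nsub (0 + M + 1) (ncat 0 (fun=> x0) a) M a.
Proof.
move=> aP; have [_ a0 _] := aP; apply: nsub_sym.
have fP : repar (0 + M + 1) M (fun s => s.-1) by split; move=> *; lia.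
have [k [l [K [k0 l0 ek el e]]]] := nsub_repar aP fP.
exists k, l, K; split=> //; apply: nhom_ext e => // s sK.
rewrite /ncat; case: ifP => h; last by congr a; lia.
by rewrite -a0; congr a; lia.
Qed.

Lemma nsub_idr M a : nloop M a -> nsub (M + 0 + 1) (ncat M a (fun=> x0)) M a.
Proof.
move=> aP; have [_ _ aM] := aP; apply: nsub_sym.
have fP : repar (M + 0 + 1) M (fun s => minn s M) by split; move=> *; lia.
have [k [l [K [k0 l0 ek el e]]]] := nsub_repar aP fP.
exists k, l, K; split=> //; apply: nhom_ext e => // s sK.
rewrite /ncat; case: ifP => h; first by congr a; lia.
by rewrite -[RHS]aM; congr a; lia.
Qed.

Lemma is_based_loopP M (a : 'I_M.+1 -> X) :
  reflect (nloop M (nx a)) (is_based_loop a).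
Proof.
apply: (iffP and3P) => [[/forallP ac /eqP a0 /eqP aM]|[ac a0 aM]].
  split; rewrite ?nx0 ?nxM // => s s' sM s'M ss'.
  have /forallP/(_ (inord s'))/implyP := ac (inord s); apply.
  by rewrite adjIE !inordK.
split; rewrite -?nx0 -?nxM ?a0 ?aM //.
apply/forallP => s; apply/forallP => s'; apply/implyP; rewrite adjIE => ss'.
by rewrite -(nxE a s) -(nxE a s'); apply: ac => //; apply: leq_ord.
Qed.

Lemma is_based_loop_ffun M (a : 'I_M.+1 -> X) :
  is_based_loop a -> is_based_loop [ffun i => a i].
Proof.
case/and3P=> /forallP ac a0 aM; apply/and3P; split; rewrite ?ffunE //.
apply/forallP => s; apply/forallP => s'; rewrite !ffunE.
by have /forallP := ac s.
Qed.

Lemma loop_nloop (a : based_loop) : nloop (len a) (nx (loop_fun a)).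
Proof. exact/is_based_loopP/loop_dataP. Qed.

Lemma subdivision_homotopicP (a b : based_loop) :
  subdivision_homotopic a b <->
  nsub (len a) (nx (loop_fun a)) (len b) (nx (loop_fun b)).
Proof.
split=> -[k [l [K [k0 l0 ek el h]]]]; exists k, l, K; split=> //.
  apply: nhom_ext (proj1 (based_homotopicP _ _) h) => s sK;
  by rewrite /nx /rho inordK.
apply/based_homotopicP; apply: nhom_ext h => s sK;
by rewrite /nx /rho inordK.
Qed.

Lemma nsub_ext M a a' N b b' : (forall s, s <= M -> a s = a' s) ->
  (forall s, s <= N -> b s = b' s) -> nsub M a N b -> nsub M a' N b'.
Proof.
move=> ea eb [k [l [K [k0 l0 ek el h]]]]; exists k, l, K; split=> //.
apply: nhom_ext h => s sK; first by rewrite ea // (div_bound ek).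
by rewrite eb // (div_bound el).
Qed.

Lemma nloop_ext M a b : (forall s, s <= M -> a s = b s) ->
  nloop M a -> nloop M b.
Proof.
move=> e [ac a0 aM]; split; rewrite -?e // => s s' sM s'M ss'.
by rewrite -!e //; apply: ac.
Qed.

Lemma nx_cat M N (a : 'I_M.+1 -> X) (b : 'I_N.+1 -> X) s : s <= M + N + 1 ->
  ncat M (nx a) (nx b) s = nx (loop_cat_fun a b) s.
Proof. by move=> sK; rewrite /nx /loop_cat_fun inordK. Qed.

Lemma nx_rev M (a : 'I_M.+1 -> X) s : s <= M ->
  nx a (M - s) = nx (loop_rev_fun a) s.
Proof.
move=> sM; rewrite /nx /loop_rev_fun; congr a; apply: val_inj.
by rewrite /= !inordK ?subSS // ltnS leq_subr.
Qed.

Lemma loop_catP (a b : based_loop) :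
  is_based_loop [ffun i => loop_cat_fun (loop_fun a) (loop_fun b) i].
Proof.
apply/is_based_loop_ffun/is_based_loopP.
exact: nloop_ext (@nx_cat _ _ _ _) (nloop_cat (loop_nloop a) (loop_nloop b)).
Qed.

Lemma loop_revP (a : based_loop) :
  is_based_loop [ffun i => loop_rev_fun (loop_fun a) i].
Proof.
apply/is_based_loop_ffun/is_based_loopP.
exact: nloop_ext (@nx_rev _ _) (nloop_rev (loop_nloop a)).
Qed.

Lemma loop_cstP : is_based_loop [ffun i : 'I_1 => x0].
Proof. exact/is_based_loop_ffun/is_based_loopP/nloop_cst. Qed.

Definition loop_cat (a b : based_loop) : based_loop := mk_loop (loop_catP a b).
Definition loop_rev (a : based_loop) : based_loop := mk_loop (loop_revP a).
Definition loop_cst : based_loop := mk_loop loop_cstP.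

Lemma len_cat a b : len (loop_cat a b) = len a + len b + 1.
Proof. by []. Qed.

Lemma nx_loop_cat a b s : s <= len a + len b + 1 ->
  ncat (len a) (nx (loop_fun a)) (nx (loop_fun b)) s =
  nx (loop_fun (loop_cat a b)) s.
Proof. by move=> sK; rewrite nx_cat // /nx /loop_fun /= ffunE. Qed.

Lemma nx_loop_rev a s : s <= len a ->
  nx (loop_fun a) (len a - s) = nx (loop_fun (loop_rev a)) s.
Proof. by move=> sK; rewrite nx_rev // /nx /loop_fun /= ffunE. Qed.

Lemma nx_loop_cst s : s <= 0 -> x0 = nx (loop_fun loop_cst) s.
Proof. by move=> _; rewrite /nx /loop_fun /= ffunE. Qed.

Definition sub_hom : rel based_loop := fun a b => `[< subdivision_homotopic a b >].

Lemma sub_homP a b : reflect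
  (nsub (len a) (nx (loop_fun a)) (len b) (nx (loop_fun b))) (sub_hom a b).
Proof.
by apply: (iffP (asboolP _)) => h; [apply/subdivision_homotopicP |
  apply/subdivision_homotopicP].
Qed.

Lemma sub_hom_refl : reflexive sub_hom.
Proof. by move=> a; apply/sub_homP/nhom_nsub/nhom_refl/loop_nloop. Qed.

Lemma sub_hom_sym : symmetric sub_hom.
Proof. by move=> a b; apply/sub_homP/sub_homP => /nsub_sym. Qed.

Lemma sub_hom_trans : transitive sub_hom.
Proof.
by move=> b a c /sub_homP h1 /sub_homP h2; apply/sub_homP/(nsub_trans h1 h2).
Qed.

Canonical sub_hom_equiv :=
  EquivRel sub_hom sub_hom_refl sub_hom_sym sub_hom_trans.

Local Open Scope quotient_scope.

Definition pi1 := {eq_quot sub_hom}.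

HB.instance Definition _ := Choice.on pi1.
HB.instance Definition _ := EqQuotient.on pi1.

Definition pi1_mul : pi1 -> pi1 -> pi1 := lift_op2 pi1 loop_cat.
Definition pi1_inv : pi1 -> pi1 := lift_op1 pi1 loop_rev.
Definition pi1_one : pi1 := \pi_pi1 loop_cst.

Lemma pi1_eqP (a b : based_loop) : reflect
  (nsub (len a) (nx (loop_fun a)) (len b) (nx (loop_fun b)))
  (\pi_pi1 a == \pi_pi1 b).
Proof. by rewrite eqmodE; apply: sub_homP. Qed.

Lemma pi1_eq_repr (a : based_loop) :
  nsub (len a) (nx (loop_fun a))
       (len (repr (\pi_pi1 a))) (nx (loop_fun (repr (\pi_pi1 a)))).
Proof. by apply/pi1_eqP; rewrite reprK. Qed.

Lemma pi1_mulE (a b : based_loop) :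
  pi1_mul (\pi_pi1 a) (\pi_pi1 b) = \pi_pi1 (loop_cat a b).
Proof.
rewrite /pi1_mul; unlock; apply/eqP/pi1_eqP.
apply: (nsub_ext (@nx_loop_cat _ _) (@nx_loop_cat a b)).
by apply: nsub_cat; try exact: loop_nloop; apply/nsub_sym/pi1_eq_repr.
Qed.

Lemma pi1_invE (a : based_loop) :
  pi1_inv (\pi_pi1 a) = \pi_pi1 (loop_rev a).
Proof.
rewrite /pi1_inv; unlock; apply/eqP/pi1_eqP.
have /nsub_rev := nsub_sym (pi1_eq_repr a).
exact: nsub_ext (@nx_loop_rev _) (@nx_loop_rev _).
Qed.

Lemma pi1_mulA : associative pi1_mul.
Proof.
elim/quotW=> a; elim/quotW=> b; elim/quotW=> c.
rewrite !pi1_mulE; apply/eqP/pi1_eqP.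
have e : len (loop_cat (loop_cat a b) c) = len (loop_cat a (loop_cat b c)).
  by rewrite !len_cat; lia.
have := nhom_nsub (nhom_refl (loop_nloop (loop_cat a (loop_cat b c)))).
rewrite -[X in nsub _ _ X]e; apply: nsub_ext => // s sK.
have {}sK : s <= len a + len b + len c + 2.
  by move: sK; rewrite !len_cat; lia.
rewrite -[RHS]nx_loop_cat; last by rewrite len_cat; lia.
rewrite -[LHS]nx_loop_cat; last by rewrite len_cat; lia.
have h := len_cat a b; rewrite /ncat; case: (leqP s (len a)) => h1.
  rewrite ifT; last by lia.
  by rewrite -nx_loop_cat /ncat ?h1 //; lia.
rewrite -[LHS]nx_loop_cat; last by lia.
rewrite /ncat; case: (leqP s (len (loop_cat a b))) => h2.
  rewrite ifT; last by lia.
  rewrite -nx_loop_cat; last by lia.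
  by rewrite /ncat ifN // -ltnNge.
rewrite ifN; last by lia.
by congr (nx _ _); lia.
Qed.

Lemma pi1_mul1 : left_id pi1_one pi1_mul.
Proof.
elim/quotW=> a; rewrite /pi1_one pi1_mulE; apply/eqP/pi1_eqP.
apply: nsub_ext (nsub_idl (loop_nloop a)) => // s sK.
rewrite -nx_loop_cat // /ncat; case: ifP => // s0.
exact: nx_loop_cst.
Qed.

Lemma pi1_mulr1 : right_id pi1_one pi1_mul.
Proof.
elim/quotW=> a; rewrite /pi1_one pi1_mulE; apply/eqP/pi1_eqP.
apply: nsub_ext (nsub_idr (loop_nloop a)) => // s sK.
rewrite -nx_loop_cat // /ncat; case: ifP => // s0.
by apply: nx_loop_cst; lia.
Qed.

Lemma pi1_mulr_inv : right_inverse pi1_one pi1_inv pi1_mul.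
Proof.
elim/quotW=> a; rewrite /pi1_one pi1_invE pi1_mulE; apply/eqP/pi1_eqP.
apply: nsub_ext (@nx_loop_cst) (nsub_invr (loop_nloop a)) => s sK.
rewrite -nx_loop_cat // /ncat; case: ifP => // s0.
by rewrite nx_loop_rev //; lia.
Qed.

Lemma pi1_invK : involutive pi1_inv.
Proof.
elim/quotW=> a; rewrite !pi1_invE; apply/eqP/pi1_eqP.
apply: nsub_ext (nhom_nsub (nhom_refl (loop_nloop a))) => // s sK.
rewrite -nx_loop_rev // -nx_loop_rev; last by rewrite leq_subr.
by rewrite subKn.
Qed.

Lemma pi1_mul_inv : left_inverse pi1_one pi1_inv pi1_mul.
Proof. by move=> a; rewrite -{2}(pi1_invK a) pi1_mulr_inv. Qed.

HB.instance Definition _ :=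
  isGroup.Build pi1 pi1_mulA pi1_mul1 pi1_mulr1 pi1_mul_inv pi1_mulr_inv.

End Loops.

(* Main.v *)
Require Import Defs.
From mathcomp Require Import all_boot all_order all_algebra.
From mathcomp Require Import finmap.
From mathcomp Require Import zify.

(** The proof is a discrete version of the covering of the circle by the line.
    Winding around a circle C of N points gives a map p : int -> C that sends
    z to the point number z modulo N; it is N-periodic, and two points are
    adjacent exactly when they have lifts at distance at most 1.

    An adjacent pair (u, v) of C has a well-defined signed displacement
    step u v in {-1, 0, 1}.  For three mutually adjacent points the sum
    step u v + step v w - step u w is a multiple of N of absolute value at
    most 3, hence it vanishes because N >= 4: this cocycle identity
    ([step_cocycle]) expresses that no triangle winds around C.  For N = 3 the
    three points would be mutually adjacent and every loop contractible.
    Summing the displacements along a loop lifts the loop to int; the lift ends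
    at a multiple of N, and dividing by N gives the winding number.

    - It is invariant: two consecutive rows of a homotopy form a ladder whose
      squares consist of mutually adjacent points, so the cocycle identity
      makes the two rows have the same total displacement ([lift_homotopic]),
      and a subdivision only inserts zero displacements ([lift_subdivision]).
    - It is additive under concatenation, as a sum is ([lift_cat]).
    - It is injective: bring two loops to the same length by subdividing them;
      their lifts then have the same end points, and lifts with the same end
      points can be deformed into one another in int ([nhom_max],
      [nhom_lift]).
    - It is surjective: the projection of a walk of |m| N unit steps of the
      sign of m winds m times ([lift_surj]). *)

Set Implicit Arguments.
Unset Strict Implicit.
Unset Printing Implicit Defensive.

(** * Lifting loops along a periodic covering of the circle *)

Section Cover.

Import Order.TTheory GRing.Theory Num.Theory.
Local Open Scope ring_scope.

Variables (n : nat) (X : {fset 'rV[int]_n}) (x0 : X).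

(** [lab] is an arbitrary section of the covering map [p]; it makes
    displacements computable from points. *)
Record circle_cover (N : nat) (p : int -> X) (lab : X -> int) : Prop := {
  cover_size : (4 <= N)%N;
  cover_base : p 0 = x0;
  cover_lab : cancel lab p;
  cover_eq : forall z w, p z = p w <-> (N%:Z %| z - w)%Z;
  cover_adj : forall z w,
    adjX (p z) (p w) <-> exists2 e, `|e| <= 1 & p (z + e) = p w }.

Variables (N : nat) (p : int -> X) (lab : X -> int).
Hypothesis pP : circle_cover N p lab.

Lemma cover_shift e z w : p z = p w -> p (z + e) = p (w + e).
Proof.
move=> /(cover_eq pP) h; apply/(cover_eq pP).
by have -> : z + e - (w + e) = z - w by lia.
Qed.

(** The bound 4 is the smallest number of points of a circle. *)
Lemma cover_inj_near z w : p z = p w -> `|z - w| < 4 -> z = w.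
Proof.
move=> /(cover_eq pP); have := cover_size pP => N4 h zw.
apply/eqP; rewrite -subr_eq0; apply: contraLR h => nz.
by rewrite dvdzE gtnNdvd //; lia.
Qed.

Lemma cover_near z w : `|w - z| <= 1 -> adjX (p z) (p w).
Proof.
by move=> zw; apply/(cover_adj pP); exists (w - z) => //; congr p; lia.
Qed.

(** The displacement from [u] to [v]; the value 0 is also returned when [u] and
    [v] are not adjacent. *)
Definition step (u v : X) : int :=
  if p (lab u + 1) == v then 1 else if p (lab u - 1) == v then -1 else 0.

Lemma step_bound u v : `|step u v| <= 1.
Proof. by rewrite /step; do 2?case: ifP. Qed.

Lemma cover_step u v z : adjX u v -> p z = u -> p (z + step u v) = v.
Proof.
move=> uv zu; have uz : p z = p (lab u) by rewrite (cover_lab pP).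
rewrite (cover_shift _ uz) /step; case: eqP => [//|up]; case: eqP => [//|dn].
move: uv; rewrite -{1}(cover_lab pP u) -{1}(cover_lab pP v).
move/(cover_adj pP); rewrite (cover_lab pP) => -[e e1 ev].
have [ee|[ee|ee]] : e = 1 \/ e = -1 \/ e = 0 by lia.
- by case: up; rewrite -ee.
- by case: dn; rewrite -ee.
by rewrite -ee.
Qed.

Lemma step_cover z w : `|w - z| <= 1 -> step (p z) (p w) = w - z.
Proof.
move=> zw; have := cover_step (cover_near zw) (erefl (p z)).
have := step_bound (p z) (p w); set e := step _ _ => e1 /cover_inj_near h.
have {h} : z + e = w by apply: h; lia.
lia.
Qed.

Lemma step_refl u : step u u = 0.
Proof. by rewrite -{1 2}(cover_lab pP u) step_cover subrr. Qed.

(** Both sides lead from the same lift of [u] to lifts of [w], so they differ by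
    a multiple of [N]; they differ by at most 3, and [N] is at least 4. *)
Lemma step_cocycle u v w : adjX u v -> adjX v w -> adjX u w ->
  step u v + step v w = step u w.
Proof.
move=> uv vw uw; have pu := cover_lab pP u.
have puw := cover_step uw pu.
have := cover_step vw (cover_step uv pu).
rewrite -[in RHS]puw => /cover_inj_near.
have := step_bound u v; have := step_bound v w; have := step_bound u w.
move: (step u v) (step v w) (step u w) => e f g eb fb gb h.
have {h} : lab u + e + f = lab u + g by apply: h; lia.
lia.
Qed.

Definition lift (a : nat -> X) (s : nat) : int :=
  \sum_(i < s) step (a i) (a i.+1).

Definition unit_steps (z : nat -> int) := forall i, `|z i.+1 - z i| <= 1.

Lemma lift0 a : lift a 0 = 0.
Proof. by rewrite /lift big_ord0. Qed.

Lemma liftS a s : lift a s.+1 = lift a s + step (a s) (a s.+1).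
Proof. by rewrite /lift big_ord_recr. Qed.

Lemma nadjS s : nadj s s.+1.
Proof. by rewrite /nadj; lia. Qed.

Lemma eq_lift a b s : (forall i, (i <= s)%N -> a i = b i) ->
  lift a s = lift b s.
Proof. by move=> e; apply: eq_bigr => i _; rewrite !e // ltnW. Qed.

Lemma cover_lift M a s : nloop x0 M a -> (s <= M)%N -> p (lift a s) = a s.
Proof.
move=> [ac a0 _]; elim: s => [|s IH] sM.
  by rewrite lift0 a0 (cover_base pP).
rewrite liftS; apply: cover_step; last exact: IH (ltnW sM).
exact: ac (ltnW sM) sM (nadjS s).
Qed.

Lemma lift_cover (z : nat -> int) s : z 0%N = 0 -> unit_steps z ->
  lift (p \o z) s = z s.
Proof.
move=> z0 zl; elim: s => [|s IH]; first by rewrite lift0 z0.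
by rewrite liftS IH /= step_cover ?zl // addrC subrK.
Qed.

(** The ladder between the rows [t] and [t + 1] is climbed rung by rung: by the
    cocycle identity, going up at column [s] and along the upper row, or along
    the lower row and up at column [s + 1], both give the displacement along the
    diagonal of the square.  The rungs at the two ends have displacement 0
    because a based homotopy is constant there. *)
Lemma lift_homotopic M a b : nhom x0 M a b -> lift a M = lift b M.
Proof.
move=> [R [H [Hc Ha Hb H0]]].
rewrite -(eq_lift Ha) -(eq_lift Hb).
suff h t : (t <= R)%N -> lift (H ^~ 0%N) M = lift (H ^~ t) M by apply: h.
elim: t => [//|t IH] tR; rewrite {}IH 1?ltnW //.
have ladder s : (s <= M)%N ->
    lift (H ^~ t) s + step (H s t) (H s t.+1) = lift (H ^~ t.+1) s.
  elim: s => [|s IH] sM.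
    by rewrite !lift0 (proj1 (H0 _ (ltnW tR))) (proj1 (H0 _ tR)) step_refl.
  rewrite !liftS -(IH (ltnW sM)) -!addrA; congr (_ + _).
  have nn i : nadj i i by rewrite /nadj leqnSn.
  rewrite !step_cocycle //; apply: Hc => //; try exact: ltnW;
    exact: nadjS.
rewrite -ladder // (proj2 (H0 _ (ltnW tR))) (proj2 (H0 _ tR)) step_refl.
by rewrite addr0.
Qed.

Lemma lift_subdivision k a s : (0 < k)%N ->
  lift (fun i => a (i %/ k)%N) s = lift a (s %/ k).
Proof.
move=> k0; elim: s => [|s IH]; first by rewrite div0n !lift0.
rewrite liftS IH divnS //; case: (k %| s.+1)%N => /=; first by rewrite -liftS.
by rewrite step_refl addr0.
Qed.

Lemma lift_nsub M a P b : nsub x0 M a P b -> lift a M = lift b P.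
Proof.
move=> [k [l [K [k0 l0 ek el /lift_homotopic]]]].
by rewrite !lift_subdivision // (div_last ek) (div_last el).
Qed.

Lemma lift_cat M P a b : a M = x0 -> b 0%N = x0 ->
  lift (ncat M a b) (M + P + 1) = lift a M + lift b P.
Proof.
move=> aM b0; rewrite -addnA addn1; elim: P => [|P IH].
  (* The junction of two concatenated loops repeats the base point, which
     contributes a zero displacement. *)
  rewrite addn1 liftS lift0 {2 3}/ncat leqnn ltnn subnn aM b0 step_refl.
  by congr (_ + _); apply: eq_lift => i iM; rewrite /ncat iM.
rewrite addnS liftS IH liftS -addrA; congr (_ + (_ + _)).
by rewrite /ncat !ifN; [congr (step (b _) (b _)); lia | lia | lia].
Qed.

Lemma unit_steps_bound (z : nat -> int) s : z 0%N = 0 -> unit_steps z ->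
  `|z s| <= s%:Z.
Proof.
move=> z0 zl; elim: s => [|s IH]; first by rewrite z0.
by have := zl s; lia.
Qed.

Lemma unit_steps_nadj (z : nat -> int) s s' : unit_steps z ->
  nadj s s' -> `|z s - z s'| <= 1.
Proof.
move=> zl ss'; have [e|[e|e]] : s' = s \/ s' = s.+1 \/ s = s'.+1.
- by move: ss'; rewrite /nadj; lia.
- by rewrite e subrr.
- by rewrite e distrC.
by rewrite e.
Qed.

Lemma lift_unit_steps a : unit_steps (lift a).
Proof. by move=> s; rewrite liftS addrC addKr step_bound. Qed.

(** The homotopy truncates [z] from above at a level [M - t] that decreases in
    time, without going below [w].  A minimum or maximum of functions that vary
    by at most 1 when [s] and [t] both vary by at most 1 has the same property,
    so the formula is continuous for the product adjacency.  By contrast,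
    moving [w] towards [z] by one unit per time step would not be: when [s] and
    [t] increase together, [w s + t] may increase by 2. *)
Lemma nhom_max M (z w : nat -> int) : z 0%N = 0 -> w 0%N = 0 ->
  unit_steps z -> unit_steps w -> z M = w M -> p (w M) = x0 ->
  nhom x0 M (fun s => p (Num.max (w s) (z s))) (p \o w).
Proof.
move=> z0 w0 zl wl zw pM.
have zb s := unit_steps_bound s z0 zl; have wb s := unit_steps_bound s w0 wl.
(* Both walks stay in [-M, M], so the level has to sweep an interval of length
   2 M. *)
exists (2 * M)%N, (fun s t => p (Num.max (w s) (Num.min (z s) (M%:Z - t%:Z)))).
split.
- move=> s s' t t' sM s'M tR t'R ss' tt'; apply: cover_near.
  have := unit_steps_nadj zl ss'; have := unit_steps_nadj wl ss'.
  by move: tt'; rewrite /nadj; lia.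
- by move=> s sM; congr p; have := zb s; lia.
- by move=> s sM /=; congr p; have := wb s; lia.
by move=> t tR; rewrite z0 w0 zw -{2}pM -(cover_base pP); split; congr p; lia.
Qed.

(** Each loop is deformed into the projection of the maximum of both lifts. *)
Lemma nhom_lift M a b : nloop x0 M a -> nloop x0 M b -> lift a M = lift b M ->
  nhom x0 M a b.
Proof.
move=> aP bP ab; have [_ _ aM] := aP; have [_ _ bM] := bP.
have max_a : nhom x0 M (fun s => p (Num.max (lift a s) (lift b s))) a.
  apply: (nhom_ext (fun _ _ => erefl) (fun s sM => cover_lift aP sM)).
  apply: nhom_max; rewrite ?lift0 ?(cover_lift aP) //; exact: lift_unit_steps.
have max_b : nhom x0 M (fun s => p (Num.max (lift b s) (lift a s))) b.
  apply: (nhom_ext (fun _ _ => erefl) (fun s sM => cover_lift bP sM)).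
  apply: nhom_max; rewrite ?lift0 ?(cover_lift bP) //; exact: lift_unit_steps.
apply: nhom_trans (nhom_sym max_a) _; apply: nhom_ext max_b => // s _.
by rewrite maxC.
Qed.

(** [nsub_lift] and [lift_nsub] together say that the end point of the lift is a
    complete invariant of loops up to subdivision-based homotopy.  Subdividing
    either loop by the number of points of the other one gives a common
    length. *)
Lemma nsub_lift M a P b : nloop x0 M a -> nloop x0 P b -> lift a M = lift b P ->
  nsub x0 M a P b.
Proof.
move=> aP bP ab.
have ek : (P.+1 * M.+1).-1.+1 = (P.+1 * M.+1)%N by lia.
have el : (P.+1 * M.+1).-1.+1 = (M.+1 * P.+1)%N by lia.
exists P.+1, M.+1, (P.+1 * M.+1).-1; split=> //; apply: nhom_lift.
- exact: nloop_sub ek aP.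
- exact: nloop_sub el bP.
by rewrite !lift_subdivision // (div_last ek) (div_last el).
Qed.

Lemma lift_surj m : exists M a, nloop x0 M a /\ lift a M = m * N%:Z.
Proof.
pose z (s : nat) : int := Num.sg m * s%:Z.
have zl : unit_steps z by move=> i; rewrite /z; case: sgrP; lia.
have z0 : z 0%N = 0 by rewrite /z mulr0.
have zM : z (`|m| * N)%N = m * N%:Z.
  by rewrite /z PoszM mulrA abszE -numEsg.
exists (`|m| * N)%N, (p \o z); split; last first.
  by rewrite lift_cover.
split=> /=.
- move=> s s' sM s'M ss'; apply: cover_near.
  by rewrite distrC; apply: unit_steps_nadj.
- by rewrite z0 (cover_base pP).
rewrite zM -(cover_base pP); apply/(cover_eq pP).
by rewrite subr0 dvdz_mull.
Qed.

(** The end point of the lift lies over the base point, as 0 does. *)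
Lemma dvd_lift M a : nloop x0 M a -> (N%:Z %| lift a M)%Z.
Proof.
move=> aP; rewrite -[lift a M]subr0; apply/(cover_eq pP).
by rewrite (cover_lift aP) // (cover_base pP); case: aP.
Qed.

(** * The winding number *)

Definition loop_wind (a : based_loop x0) : int :=
  (lift (nx (loop_fun a)) (len a) %/ N%:Z)%Z.

Definition wind (c : pi1 x0) : int := loop_wind (repr c).

Lemma wind_eqP (a b : based_loop x0) :
  loop_wind a = loop_wind b <->
  nsub x0 (len a) (nx (loop_fun a)) (len b) (nx (loop_fun b)).
Proof.
split=> [ab|/lift_nsub ab]; last by rewrite /loop_wind ab.
apply: nsub_lift; [exact: loop_nloop..|].
by rewrite -(divzK (dvd_lift (loop_nloop a))) -/(loop_wind a) ab divzK
  // dvd_lift //; apply: loop_nloop.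
Qed.

Local Open Scope quotient_scope.

Lemma windE (a : based_loop x0) : wind (\pi_(pi1 x0) a) = loop_wind a.
Proof. by symmetry; apply/wind_eqP/pi1_eq_repr. Qed.

Lemma windM (c d : pi1 x0) : wind (c * d)%g = wind c + wind d.
Proof.
elim/quotW: c => a; elim/quotW: d => b.
rewrite [(_ * _)%g]pi1_mulE !windE /loop_wind.
rewrite -(eq_lift (@nx_loop_cat _ _ _ a b)) lift_cat; last 2 first.
- by case: (loop_nloop a).
- by case: (loop_nloop b).
by rewrite divzDl // dvd_lift //; apply: loop_nloop.
Qed.

Lemma wind_inj : injective wind.
Proof.
elim/quotW=> a; elim/quotW=> b; rewrite !windE => /wind_eqP ab.
exact/eqP/pi1_eqP.
Qed.

Lemma wind_surj m : exists c, wind c = m.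
Proof.
have [M [a [aP am]]] := lift_surj m.
pose f (i : 'I_M.+1) := a i.
have fa s : (s <= M)%N -> a s = nx f s by move=> sM; rewrite /f /nx inordK.
have fP : is_based_loop x0 [ffun i => f i].
  exact/is_based_loop_ffun/is_based_loopP/(nloop_ext fa).
exists (\pi_(pi1 x0) (mk_loop fP)); rewrite windE /loop_wind.
have -> : lift (nx (loop_fun (mk_loop fP))) (len (mk_loop fP)) = m * N%:Z.
  by rewrite -am; apply: eq_lift => i iM; rewrite fa // /nx /loop_fun /= ffunE.
by rewrite mulzK //; have := cover_size pP; lia.
Qed.

Lemma wind_bij : bijective wind.
Proof.
have ex m : exists c, wind c == m by have [c <-] := wind_surj m; exists c.
exists (fun m => xchoose (ex m)) => [c|m]; last exact/eqP/(xchooseP (ex m)).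
by apply: wind_inj; apply/eqP/(xchooseP (ex (wind c))).
Qed.

End Cover.

(** * The covering of a digital circle *)

Section CircleCover.

Import Order.TTheory GRing.Theory Num.Theory.
Local Open Scope ring_scope.

Definition zmod_ord (N : nat) (z : int) : 'I_N.+1 := inord `|(z %% N.+1)%Z|.

Lemma val_zmod_ord N z : (zmod_ord N z)%:Z = (z %% N.+1)%Z.
Proof.
have h0 := modz_ge0 z (isT : N.+1%:Z != 0).
have hN := ltz_mod z (isT : N.+1%:Z != 0).
by rewrite inordK; lia.
Qed.

Lemma zmod_ord_eq N z w : zmod_ord N z = zmod_ord N w <-> (N.+1%:Z %| z - w)%Z.
Proof.
rewrite -eqz_mod_dvd -!val_zmod_ord; split=> [->|]; first exact: eqxx.
by move=> /eqP[/val_inj].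
Qed.

Lemma zmod_ord_val N (i : 'I_N.+1) : zmod_ord N i%:Z = i.
Proof.
apply/val_inj/eqP; rewrite -eqz_nat /= val_zmod_ord modz_nat modn_small //.
Qed.

Lemma zmod_ordS N z : zmod_ord N (z + 1) = ordS (zmod_ord N z).
Proof.
rewrite -[RHS]zmod_ord_val; apply/zmod_ord_eq; rewrite -eqz_mod_dvd /=.
rewrite -modz_nat modz_mod [(zmod_ord N z).+1%:Z]intS val_zmod_ord addrC.
by rewrite modzDmr.
Qed.

(** The origin of int is placed over the base point by shifting residues by the
    index of [x0] in the cyclic enumeration of the circle. *)
Lemma circle_coverP (n N : nat) (C : {fset 'rV[int]_n}) (x0 : C) :
  digital_circle N C -> exists p lab, circle_cover x0 N p lab.
Proof.
case: N => [[]//|N] [_ N4 [x [xI xC xadj]]].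
have ex (u : C) : exists i, x i == val u.
  by have := valP u; rewrite xC => /codomP[i ->]; exists i.
pose ix u := xchoose (ex u).
have ixK u : x (ix u) = val u by apply/eqP/(xchooseP (ex u)).
pose idx z := zmod_ord N (z + (ix x0)%:Z).
have idx_eq z w : idx z = idx w <-> (N.+1%:Z %| z - w)%Z.
  rewrite zmod_ord_eq.
  by have -> : z + (ix x0)%:Z - (w + (ix x0)%:Z) = z - w by lia.
have idxS z : idx (z + 1) = ordS (idx z) by rewrite /idx addrAC zmod_ordS.
pose p z : C := insubd x0 (x (idx z)).
have pE z : val (p z) = x (idx z) by rewrite val_insubd xC codom_f.
have p_eq z w : p z = p w <-> idx z = idx w.
  split=> [/(congr1 val)|e]; last by rewrite /p e.
  by rewrite !pE => /xI.
have idx_ix u : idx ((ix u)%:Z - (ix x0)%:Z) = ix u.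
  by rewrite /idx subrK zmod_ord_val.
have labK : cancel (fun u => (ix u)%:Z - (ix x0)%:Z) p.
  by move=> u; apply: val_inj; rewrite pE idx_ix ixK.
exists p, (fun u => (ix u)%:Z - (ix x0)%:Z); split=> //.
- by have := labK x0; rewrite subrr.
- by move=> z w; rewrite p_eq.
(* The circle axiom is symmetric: [w] may precede [z] in the cyclic order, in
   which case the displacement is -1. *)
have back z w : idx z = idx (w + 1) <-> idx (z - 1) = idx w.
  by rewrite !idx_eq; have -> : z - (w + 1) = z - 1 - w by lia.
move=> z w; rewrite /adjX !pE.
have [zw|zw] := eqVneq (idx z) (idx w).
  split=> [_|_]; first by exists 0 => //; rewrite addr0 p_eq.
  by rewrite zw -pE; exact: adjX_refl.
rewrite xadj // -!idxS; split.
  case/orP=> /eqP e; first by exists 1 => //; rewrite p_eq e.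
  by exists (-1) => //; rewrite p_eq -back.
case=> e e1 /p_eq h.
have [ee|[ee|ee]] : e = 1 \/ e = -1 \/ e = 0 by lia.
- by rewrite -h ee eqxx.
- by apply/orP; right; apply/eqP/back; rewrite -h ee.
by move: zw; rewrite -h ee addr0 eqxx.
Qed.

End CircleCover.

Theorem theorem5p2 (n N : nat) (C : {fset 'rV[int]_n}) (x0 : C) :
  digital_circle N C ->
  exists phi : pi1 x0 -> int,
    bijective phi /\
    forall a b : pi1 x0, phi (a * b)%g = (phi a + phi b)%R.
Proof.
move=> /(@circle_coverP _ _ _ x0)[p [lab pP]].
exists (wind N p lab); split; first exact: wind_bij pP.
exact: windM pP.
Qed.
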